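(* Let $\lambda$, $\mathsf a=(\mathsf a_{\ell})_{\ell\ge0}$, $\mathsf b=(\mathsf b_{\ell,\ell'})_{\ell,\ell'\ge0}$, $\mathsf c=(\mathsf c_{\ell,\ell'})_{\ell,\ell'\ge0}$, $\mathsf d=(\mathsf d_{\ell,\ell'})_{\ell,\ell'\ge0}$, $\mathsf e=(\mathsf e_\ell)_{\ell\ge0}$ be indeterminates, and for $n\ge0$ define $$\begin{aligned}\widehat Q_n(\mathsf a,\mathsf b,\mathsf c,\mathsf d,\mathsf e,\lambda)=\sum_{\sigma\in\mathfrak S_n}\lambda^{\mathrm{cyc}(\sigma)}\;&\prod_{i\in\mathrm{cval}}\mathsf a_{\mathrm{ucross}(i,\sigma)+\mathrm{unest}(i,\sigma)}\prod_{i\in\mathrm{cpeak}}\mathsf b_{\mathrm{lcross}(i,\sigma),\,\mathrm{lnest}(i,\sigma)}\prod_{i\in\mathrm{cdfall}}\mathsf c_{\mathrm{lcross}(i,\sigma),\,\mathrm{lnest}(i,\sigma)}\\&\times\prod_{i\in\mathrm{cdrise}}\mathsf d_{\mathrm{ucross}(i,\sigma)+\mathrm{unest}(i,\sigma),\;\mathrm{unest}(\sigma^{-1}(i),\sigma)}\prod_{i\in\mathrm{fix}}\mathsf e_{\mathrm{lev}(i,\sigma)}.\end{aligned}$$ Then $$\sum_{n=0}^\infty \widehat Q_n(\mathsf a,\mathsf b,\mathsf c,\mathsf d,\mathsf e,\lambda)\,t^n=\cfrac{1}{1-\gamma_0 t-\cfrac{\beta_1t^2}{1-\gamma_1t-\cfrac{\beta_2t^2}{1-\gamma_2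 t-\cdots}}}$$ with coefficients $$\gamma_n=\mathsf c^\star_{n-1}+\mathsf d^\natural_{n-1}+\lambda\,\mathsf e_n\quad(n\ge0),\qquad \beta_n=(\lambda+n-1)\,\mathsf a_{n-1}\,\mathsf b^\star_{n-1}\quad(n\ge1),$$ where $$\mathsf b^\star_{n-1}=\sum_{\ell=0}^{n-1}\mathsf b_{\ell,n-1-\ell},\qquad \mathsf c^\star_{n-1}=\sum_{\ell=0}^{n-1}\mathsf c_{\ell,n-1-\ell},\qquad \mathsf d^\natural_{n-1}=\sum_{\ell=0}^{n-1}\mathsf d_{n-1,\ell}$$ (so that $\mathsf c^\star_{-1}=\mathsf d^\natural_{-1}=0$).
   Context: $\mathfrak S_n$ is the set of permutations of $[n]=\{1,\dots,n\}$. Continued fractions are identities of formal power series in $t$. For $\sigma\in\mathfrak S_n$, $\mathrm{cyc}(\sigma)$ is the number of cycles (including fixed points). An index $i\in[n]$ is a cycle peak (cpeak) if $\sigma^{-1}(i)<i>\sigma(i)$; a cycle valley (cval) if $\sigma^{-1}(i)>i<\sigma(i)$; a cycle double rise (cdrise) if $\sigma^{-1}(i)<i<\sigma(i)$; a cycle double fall (cdfall) if $\sigma^{-1}(i)>i>\sigma(i)$; a fixed point (fix) if $\sigma(i)=i$. Products over $i\in\mathrm{cval}$ etc. run over the indices of $\sigma$ of that type. Index-refined statistics (quadruplets and triplets in $[n]$): $\mathrm{ucross}(j,\sigma)=\#\{i<j<k<l:\ k=\sigma(i),\ l=\sigma(j)\}$, $\mathrm{unest}(j,\sigma)=\#\{i<j<k<l:\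 k=\sigma(j),\ l=\sigma(i)\}$, $\mathrm{lcross}(k,\sigma)=\#\{i<j<k<l:\ i=\sigma(k),\ j=\sigma(l)\}$, $\mathrm{lnest}(k,\sigma)=\#\{i<j<k<l:\ i=\sigma(l),\ j=\sigma(k)\}$ (in the first two the index $j$ is fixed and one counts triples $(i,k,l)$; in the last two $k$ is fixed and one counts triples $(i,j,l)$). For a fixed point $j$, $\mathrm{lev}(j,\sigma)=\#\{i<j:\sigma(i)>j\}=\#\{l>j:\sigma(l)<j\}$. *)

(* Defs.v *)
From mathcomp Require Import all_boot all_order all_fingroup all_algebra.
Set Implicit Arguments.
Unset Strict Implicit.
Unset Printing Implicit Defensive.
Import GRing.Theory.
Local Open Scope ring_scope.

(* 'I_n = {0, ..., n-1} stands for [n] = {1, ..., n}: everything below except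
   the enumeration itself depends only on the order of the indices. *)
Section Statistics.
Variables (n : nat) (s : 'S_n).
Implicit Types i j k l : 'I_n.

Definition cyc : nat := #|porbits s|.

Definition cpeak i : bool := ((s^-1)%g i < i)%N && (s i < i)%N.
Definition cval i : bool := (i < (s^-1)%g i)%N && (i < s i)%N.
Definition cdrise i : bool := ((s^-1)%g i < i)%N && (i < s i)%N.
Definition cdfall i : bool := (i < (s^-1)%g i)%N && (s i < i)%N.
Definition cfix i : bool := s i == i.

(* The triples counted are (i, k, l). *)
Definition ucross j : nat :=
  #|[set x : 'I_n * 'I_n * 'I_n | let: (i, k, l) := x in
      [&& i < j, j < k, k < l, k == s i & l == s j]%N]|.
Definition unest j : nat :=
  #|[set x : 'I_n * 'I_n * 'I_n | let: (i, k, l) := x in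
      [&& i < j, j < k, k < l, k == s j & l == s i]%N]|.

(* The triples counted are (i, j, l). *)
Definition lcross k : nat :=
  #|[set x : 'I_n * 'I_n * 'I_n | let: (i, j, l) := x in
      [&& i < j, j < k, k < l, i == s k & j == s l]%N]|.
Definition lnest k : nat :=
  #|[set x : 'I_n * 'I_n * 'I_n | let: (i, j, l) := x in
      [&& i < j, j < k, k < l, i == s l & j == s k]%N]|.

Definition lev j : nat := #|[set i : 'I_n | (i < j)%N && (j < s i)%N]|.

Lemma lev_sym j : cfix j -> lev j = #|[set l : 'I_n | (j < l)%N && (s l < j)%N]|.
Proof.
move=> /eqP sj; rewrite /lev.
have sNj i : i != j -> (s i : nat) != j.
  by apply: contra => /eqP/val_inj sij; rewrite -(inj_eq (@perm_inj _ s)) sj sij.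
pose A := [set i : 'I_n | (i < j)%N && (s i < j)%N].
apply: (@addnI #|A|).
transitivity #|[set i : 'I_n | (i < j)%N]|.
  rewrite -[RHS](cardsID A); congr (_ + _)%N; apply: eq_card => i; rewrite !inE.
    by rewrite andbA andbb.
  case: ltnP => //= lij; rewrite andbT -leqNgt ltn_neqAle [X in ~~ X]eq_sym.
  by rewrite sNj // neq_ltn lij.
transitivity #|[set i : 'I_n | (s i < j)%N]|; last first.
  rewrite -[LHS](cardsID A); congr (_ + _)%N; apply: eq_card => i; rewrite !inE.
    by rewrite andbCA andbb.
  case sij: (s i < j)%N; rewrite ?andbT ?andbF //= -leqNgt [RHS]ltn_neqAle.
  suff /negPf -> : (j : nat) != i by [].
  by apply: contraL sij => /eqP/val_inj <-; rewrite sj ltnn.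
rewrite -[RHS](card_imset _ (@perm_inj _ s)); apply: eq_card => i; rewrite inE.
apply/idP/imsetP => [ltij|[x]]; last by rewrite inE => ? ->.
by exists ((s^-1)%g i); rewrite ?inE permKV.
Qed.

End Statistics.

Definition Qhat (R : comNzRingType) (a : nat -> R) (b c d : nat -> nat -> R)
    (e : nat -> R) (lam : R) (n : nat) : R :=
  \sum_(s : 'S_n) lam ^+ cyc s
    * (\prod_(i | cval s i) a (ucross s i + unest s i)%N)
    * (\prod_(i | cpeak s i) b (lcross s i) (lnest s i))
    * (\prod_(i | cdfall s i) c (lcross s i) (lnest s i))
    * (\prod_(i | cdrise s i)
         d (ucross s i + unest s i)%N (unest s ((s^-1)%g i)))
    * (\prod_(i | cfix s i) e (lev s i)).

(* Shifted by one, so that the index -1 makes sense: pred_star f n is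
   f^star_{n-1} and pred_natural d n is d^natural_{n-1}; both vanish at n = 0. *)
Definition pred_star (R : comNzRingType) (f : nat -> nat -> R) (n : nat) : R :=
  \sum_(l < n) f l (n - 1 - l)%N.
Definition pred_natural (R : comNzRingType) (d : nat -> nat -> R) (n : nat) : R :=
  \sum_(l < n) d (n - 1)%N l.

(* A formal power series in t is its sequence of coefficients. *)
Definition fps (R : comNzRingType) : Type := nat -> R.

Section PowerSeries.
Variable R : comNzRingType.
Implicit Types f g u : fps R.

(* The monomial x t^k. *)
Definition fps_monom (x : R) (k : nat) : fps R := fun n => x *+ (n == k).
Definition fps_one : fps R := fps_monom 1 0.
Definition fps_sub f g : fps R := fun n => f n - g n.
Definition fps_mul f g : fps R := fun n => \sum_(i < n.+1) f i * g (n - i)%N.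
Definition fps_exp f (k : nat) : fps R := iter k (fps_mul f) fps_one.

(* 1/f = \sum_k (1 - f)^k, meant for series f with constant term 1: the terms
   with k > n do not contribute to the coefficient of t^n. *)
Definition fps_inv f : fps R :=
  fun n => \sum_(k < n.+1) fps_exp (fps_sub fps_one f) k n.

Lemma fps_exp_small u k n : u 0%N = 0 -> (n < k)%N -> fps_exp u k n = 0.
Proof.
move=> u0; elim: k n => // k IH n ltnk; apply: big1 => -[[|i] lti] _ /=.
  by rewrite u0 mul0r.
rewrite [X in _ * X]IH ?mulr0 //; case: n ltnk lti => // n ltnk _.
by rewrite subSS (leq_ltn_trans (leq_subr _ _)).
Qed.

Lemma fps_mulV f : f 0%N = 1 -> fps_mul f (fps_inv f) =1 fps_one.
Proof.
move=> f0 n; set u := fps_sub fps_one f.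
have u0 : u 0%N = 0 by rewrite /u /fps_sub /fps_one /fps_monom f0 subrr.
have fE i : f i = fps_one i - u i by rewrite /u /fps_sub subKr.
rewrite /fps_mul (eq_bigr (fun i : 'I_n.+1 => fps_one i * fps_inv f (n - i)%N
  - u i * fps_inv f (n - i)%N)); last by move=> i _; rewrite fE mulrBl.
rewrite sumrB big_ord_recl big1 ?addr0; last first.
  by move=> i _; rewrite /fps_one /fps_monom /= mul0r.
rewrite subn0 mul1r.
have -> : \sum_(i < n.+1) u i * fps_inv f (n - i)%N
        = \sum_(k < n.+1) fps_exp u k.+1 n.
  under [RHS]eq_bigr => k _ do rewrite /fps_exp iterS -/(fps_exp u k) /fps_mul.
  rewrite exchange_big /=; apply: eq_bigr => i _; rewrite -mulr_sumr; congr (_ * _).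
  rewrite /fps_inv -/u (big_ord_widen n.+1 (fun k => fps_exp u k (n - i)%N)) ?ltnS ?leq_subr //.
  rewrite big_mkcond; apply: eq_bigr => k _; case: ifP => // /negbT.
  by rewrite -leqNgt => lt; rewrite fps_exp_small.
rewrite /fps_inv -/u; set F := fun k => fps_exp u k n.
have -> : \sum_(k < n.+1) fps_exp u k.+1 n = \sum_(k < n.+1) F k.+1 by [].
rewrite [X in X - _]big_ord_recl [X in _ - X]big_ord_recr /=.
have -> : F n.+1 = 0 by apply: fps_exp_small.
by rewrite addr0 addrK.
Qed.

(* jconv gam bet m k is the finite continued fraction
     1/(1 - gam_m t - bet_{m+1} t^2/(1 - ... - bet_{m+k} t^2/(1 - gam_{m+k} t))).
   The value of bet at 0 is never used. *)
Fixpoint jconv (gam bet : nat -> R) (m k : nat) : fps R :=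
  let den := fps_sub fps_one (fps_monom (gam m) 1) in
  match k with
  | 0 => fps_inv den
  | k'.+1 =>
      fps_inv (fps_sub den (fps_mul (fps_monom (bet m.+1) 2) (jconv gam bet m.+1 k')))
  end.

(* f is the value of the infinite continued fraction with coefficients gam and
   bet: its convergents tend to f in the t-adic topology. *)
Definition is_Jfraction f (gam bet : nat -> R) : Prop :=
  forall n, exists K, forall k, (K <= k)%N ->
    forall m, (m <= n)%N -> jconv gam bet 0 k m = f m.

End PowerSeries.

(* Main.v *)
Require Import Defs.
From mathcomp Require Import all_boot all_order all_fingroup all_algebra.
From mathcomp Require Import zify ring.
Set Implicit Arguments.
Unset Strict Implicit.
Unset Printing Implicit Defensive.
Import GRing.Theory.
Local Open Scope ring_scope.

(** Every weight in the sum depends, at a vertex k, only on how many arcs the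
vertices below k leave open and on which of them are closed at k. So the
permutations can be scanned from left to right, one vertex at a time, and this
gives a transfer recursion on the number h of open arcs.

Just before a vertex is read, the arcs between the vertices to its left form
closed cycles and h open paths. Each path has an initial vertex, which still
lacks a preimage, and a final vertex, which still lacks an image. The new vertex
is of one of five types.
- A cycle valley starts a new path and has weight a_h.
- A fixed point closes a cycle by itself: lambda e_h.
- A cycle double rise prolongs one of the h paths at its final vertex. Its
  weight is d_(h-1,x), where x is the rank of the final vertex used, and the
  sum over x is d^natural_(h-1).
- A cycle double fall prolongs a path at its initial vertex. Its weight is
  c_(h-1-y,y), where y is the rank of the initial vertex used, and the sum over
  y is c^star_(h-1).
- A cycle peak joins the final vertex of rank x to the initial vertex of rank
  y, with weight b_(h-1-y,y). For fixed y exactly one of the h values of x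
  belongs to the same path and closes a cycle, so the sum over x of the powers
  of lambda is lambda + h - 1, whatever the paths are.
Hence the sum over all completions of a partial permutation depends only on h
and on the number of remaining vertices. It is a sum over weighted Motzkin
paths (open_sum_motzkin), and Flajolet's theorem (motzkin_Jfraction) turns that
sum into the continued fraction.

Contracting each open path to a point turns a completion into a permutation u
of h + m letters, m being the number of remaining vertices: u sends out-slots
(final vertices by rank, then remaining vertices) to in-slots (initial vertices
by rank, then remaining vertices). No letter below h may be sent below h, since
such an arc would have been closed before.
A second permutation v, fixing all letters from h on, sends the rank of the
initial vertex of a path to the rank of its final vertex. The cycles still to be
closed are those of u * v, which acts by u first. Closing an arc deletes one
out-slot p and one in-slot q, that is, it writes u as lift_perm p q s; reglue is
the effect on v, and cyc_contract the effect on the number of cycles. *)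

(** * Continued fractions and weighted Motzkin paths *)

Section MotzkinPaths.
Variable R : comNzRingType.
Implicit Types f g u J W : fps R.

(** Truncating to polynomials transports the ring laws to power series: a
coefficient of a product only involves coefficients of smaller index. *)
Lemma fps_mul_coef f g n N : (n < N)%N ->
  fps_mul f g n = ((\poly_(i < N) f i) * (\poly_(i < N) g i))`_n.
Proof.
move=> nN; rewrite coefM; apply: eq_bigr => i _; rewrite !coef_poly.
by rewrite (leq_trans (ltn_ord i) nN) (leq_ltn_trans (leq_subr i n) nN).
Qed.

Lemma fps_mulC f g : fps_mul f g =1 fps_mul g f.
Proof. by move=> n; rewrite !(fps_mul_coef _ _ (ltnSn n)) mulrC. Qed.

Lemma eq_fps_mul f f' g g' :
  f =1 f' -> g =1 g' -> fps_mul f g =1 fps_mul f' g'.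
Proof. by move=> ef eg n; apply: eq_bigr => i _; rewrite ef eg. Qed.

Lemma fps_mulA f g u : fps_mul f (fps_mul g u) =1 fps_mul (fps_mul f g) u.
Proof.
move=> n; pose P f := \poly_(i < n.+1) f i : {poly R}.
transitivity (P f * (P g * P u))`_n; last first.
  rewrite mulrA [LHS]coefM; apply: eq_bigr => i _; have := ltn_ord i.
  by rewrite (fps_mul_coef _ _ (ltn_ord i)) ltnS => ni;
    rewrite [(P u)`_ _]coef_poly ltnS leq_subr.
rewrite [RHS]coefM; apply: eq_bigr => i _; rewrite [(P f)`_i]coef_poly ltn_ord.
by rewrite (@fps_mul_coef _ _ _ n.+1) // ltnS leq_subr.
Qed.

Lemma fps_mulCA f g u : fps_mul f (fps_mul g u) =1 fps_mul g (fps_mul f u).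
Proof.
move=> n; rewrite !fps_mulA; apply: eq_fps_mul => //; exact: fps_mulC.
Qed.

Lemma fps_mul_sub f g u n :
  fps_mul (fps_sub f g) u n = fps_mul f u n - fps_mul g u n.
Proof. by rewrite /fps_mul -sumrB; apply: eq_bigr => i _; rewrite mulrBl. Qed.

Lemma fps_mul_monom x k f n :
  fps_mul (fps_monom x k) f n = if (k <= n)%N then x * f (n - k)%N else 0.
Proof.
rewrite /fps_mul /fps_monom; have [kn|nk] := leqP k n.
  rewrite (bigD1 (Ordinal (kn : (k < n.+1)%N))) //= eqxx mulr1n big1 ?addr0 //
    => i.
  by rewrite -(inj_eq val_inj) /= => /negPf ->; rewrite mulr0n mul0r.
apply: big1 => i _; have := ltn_ord i; rewrite ltnS => ni.
by rewrite ltn_eqF ?mulr0n ?mul0r // (leq_ltn_trans ni).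
Qed.

Lemma fps_mul1 f : fps_mul (@fps_one R) f =1 f.
Proof. by move=> n; rewrite fps_mul_monom /= subn0 mul1r. Qed.

Section Convergents.
Variables gam bet : nat -> R.
Local Notation jconv := (jconv gam bet).

(** The series bet_h t J_h, with J_h the depth k convergent that starts at level
h: it counts the Motzkin paths that start at level h and end with their first
step below h. *)
Definition level_drop h k : fps R :=
  fps_mul (fps_monom (bet h) 1) (jconv h k).

Definition jconv_den h k : fps R :=
  let den := fps_sub (@fps_one R) (fps_monom (gam h) 1) in
  if k is k'.+1 then
    fps_sub den (fps_mul (fps_monom (bet h.+1) 2) (jconv h.+1 k'))
  else den.

Lemma jconv_den0 h k : jconv_den h k 0%N = 1.
Proof.
by case: k => [|k]; rewrite /= /fps_sub ?fps_mul_monom /fps_one /fps_monom /=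
  mulr0n !subr0.
Qed.

Lemma jconv_mulV h k : fps_mul (jconv_den h k) (jconv h k) =1 @fps_one R.
Proof. by case: k (jconv_den0 h k) => [|k] den0; apply: fps_mulV. Qed.

Lemma jconv0 h k : jconv h k 0%N = 1.
Proof.
by have := jconv_mulV h k 0%N; rewrite /fps_mul big_ord1 jconv_den0 mul1r.
Qed.

(** This is J_h = 1 + gam_h t J_h + t (bet_(h+1) t J_(h+1)) J_h, the equation
that defines the convergent, with the denominator cleared. *)
Lemma jconv_rec h k n :
  jconv h k.+1 n.+1
  = gam h * jconv h k.+1 n + fps_mul (level_drop h.+1 k) (jconv h k.+1) n.
Proof.
have := jconv_mulV h k.+1 n.+1; rewrite /jconv_den !fps_mul_sub fps_mul1.
rewrite [RHS]/= /fps_one /fps_monom mulr0n -/(fps_monom _ _) -fps_mulA.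
rewrite /level_drop -fps_mulA !fps_mul_monom subn1 /= => /eqP.
by rewrite -addrA -opprD subr_eq0 => /eqP ->; rewrite !subSS.
Qed.

(** Multiply J_h = 1 + gam_h t J_h + t W J_h by bet_h t f. *)
Lemma drop_mul_rec h k W f n :
    (forall i,
       jconv h k i.+1 = gam h * jconv h k i + fps_mul W (jconv h k) i) ->
  let g := fps_mul (level_drop h k) f in
  g n.+1 = gam h * g n + fps_mul W g n + bet h * f n.
Proof.
move=> JS g; set J := jconv h k in JS.
have gE : g =1 fps_mul (fps_monom (bet h) 1) (fps_mul J f).
  by move=> i; rewrite /g /level_drop -fps_mulA.
have WgE :
  fps_mul W g =1 fps_mul (fps_monom (bet h) 1) (fps_mul (fps_mul W J) f).
  move=> i; rewrite (eq_fps_mul (frefl _) gE) fps_mulCA.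
  by apply: eq_fps_mul => // j; apply: fps_mulA.
rewrite !gE WgE !fps_mul_monom subn1 /=.
case: n => [|n] /=; first by rewrite !mulr0 !add0r /fps_mul big_ord1 /J jconv0
  mul1r.
rewrite subn1 /= {1}/fps_mul big_ord_recl /= subn0 /J jconv0 mul1r -/J.
have -> : \sum_(i < n.+1) J i.+1 * f (n.+1 - i.+1)%N
        = gam h * fps_mul J f n + fps_mul (fps_mul W J) f n.
  rewrite /fps_mul big_distrr -big_split /=; apply: eq_bigr => i _.
  by rewrite JS subSS -/(fps_mul W J i); ring.
ring.
Qed.

(** The series of Motzkin paths from level h down to level 0 that stay at level
at most k, factored at the first visits to h-1, h-2, ..., 0. *)
Fixpoint tower k h : fps R :=
  if h is h'.+1 then fps_mul (level_drop h (k - h)) (tower k h') else jconv 0 k.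

Lemma tower0 k h : tower k h 0%N = (h == 0%N)%:R.
Proof.
case: h => [|h] /=; first exact: jconv0.
by rewrite /level_drop -fps_mulA fps_mul_monom.
Qed.

(** The truncated tower satisfies, below the truncation level, the first-step
recursion of Motzkin paths. *)
Lemma tower_rec k h n : (h < k)%N ->
  tower k h n.+1 = gam h * tower k h n + tower k h.+1 n
                   + (if h is h'.+1 then bet h * tower k h' n else 0).
Proof.
case: h => [|h] hk.
  rewrite addr0; case: k hk => // k _.
  by rewrite [LHS]jconv_rec /tower subn1.
have JS i : jconv h.+1 (k - h.+1) i.+1 = gam h.+1 * jconv h.+1 (k - h.+1) i
    + fps_mul (level_drop h.+2 (k - h.+2)) (jconv h.+1 (k - h.+1)) i.
  by rewrite -[(k - h.+1)%N]prednK ?subn_gt0 // jconv_rec -subnS.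
exact: (drop_mul_rec _ _ JS).
Qed.

End Convergents.

Section Motzkin.
Variables gam up down bet : nat -> R.
Hypothesis betE : forall h, bet h.+1 = up h * down h.+1.

(** Weighted Motzkin paths with m steps from height h to height 0, a step being
weighted by the height that it leaves. *)
Fixpoint motzkin (m h : nat) : R :=
  if m is m'.+1 then
    gam h * motzkin m' h + up h * motzkin m' h.+1
    + (if h is h'.+1 then down h * motzkin m' h' else 0)
  else (h == 0%N)%:R.

(** A path from h to 0 steps from j.+1 to j once more than from j to j.+1, for
each j < h. Moving all the weight to the down steps therefore costs the product
of the up j. The truncation at k is harmless, since a path of n steps from h
stays at height at most h + n. *)
Lemma tower_motzkin k h n : (h + n <= k)%N ->
  tower gam bet k h n = (\prod_(j < h) up j) * motzkin n h.
Proof.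
elim: n h => [|n IH] h hk.
  by rewrite tower0; case: h {hk} => [|h] /=; rewrite ?big_ord0 ?mul1r ?mulr0.
rewrite tower_rec; last by lia.
rewrite !IH; try lia; rewrite big_ord_recr /=.
case: h hk => [|h] hk; first by rewrite big_ord0; ring.
rewrite IH; last by lia.
rewrite big_ord_recr /= betE; ring.
Qed.

(** Flajolet's theorem: the convergent of depth k is the series of the paths of
height at most k, hence it is exact up to order k. *)
Lemma motzkin_Jfraction f : (forall n, f n = motzkin n 0) ->
  is_Jfraction f gam bet.
Proof.
move=> fE n; exists n => k nk m mn; rewrite fE.
have := @tower_motzkin k 0 m; rewrite big_ord0 mul1r add0n; apply; lia.
Qed.

End Motzkin.

End MotzkinPaths.

Arguments motzkin : simpl never.

(** * Deleting an arc of a permutation *)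

Section Contraction.
Variable n : nat.
Implicit Types (p q x y : 'I_n.+1) (s t g : 'S_n) (u v : 'S_n.+1).

Lemma lift_perm_inj p q : injective (@lift_perm n p q).
Proof.
move=> s t est; apply/permP=> k; apply: (@lift_inj _ q).
by rewrite -!(lift_perm_lift p) est.
Qed.

(** drop_perm inverts lift_perm p (u p): it deletes the arc from p to u p and
relabels. *)
Definition drop_fun p u (k : 'I_n) : 'I_n :=
  odflt k (unlift (u p) (u (lift p k))).

Lemma lift_drop_fun p u k : lift (u p) (drop_fun p u k) = u (lift p k).
Proof.
rewrite /drop_fun; have := neq_lift p k.
by rewrite -(inj_eq (@perm_inj _ u)) => /unlift_some[? ? ->].
Qed.

Lemma drop_fun_inj p u : injective (drop_fun p u).
Proof.
move=> j k ejk; apply: (@lift_inj _ p); apply: (@perm_inj _ u).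
by rewrite -!lift_drop_fun ejk.
Qed.

Definition drop_perm p u : 'S_n := perm (@drop_fun_inj p u).

Lemma lift_drop_perm p u : lift_perm p (u p) (drop_perm p u) = u.
Proof.
apply/permP=> k; case: (unliftP p k) => [j|] ->; last by rewrite lift_perm_id.
by rewrite lift_perm_lift permE lift_drop_fun.
Qed.

Lemma sum_lift_perm (R : nmodType) p q (P : pred 'S_n.+1) (F : 'S_n.+1 -> R) :
  \sum_(u | P u && (u p == q)) F u =
  \sum_(s : 'S_n | P (lift_perm p q s)) F (lift_perm p q s).
Proof.
rewrite (reindex (lift_perm p q)) /=; last first.
  exists (drop_perm p) => [s _|u].
    have := lift_drop_perm p (lift_perm p q s).
    by rewrite lift_perm_id => /lift_perm_inj.
  by rewrite inE => /andP[_ /eqP <-]; rewrite lift_drop_perm.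
by apply: eq_bigl => s; rewrite lift_perm_id eqxx andbT.
Qed.

Lemma lift_perm_exp p s i k :
  (lift_perm p p s ^+ i)%g (lift p k) = lift p ((s ^+ i)%g k).
Proof.
elim: i => [|i IH]; first by rewrite !expg0 !perm1.
by rewrite !expgSr !permM IH lift_perm_lift.
Qed.

Lemma porbit_lift_perm p s k :
  porbit (lift_perm p p s) (lift p k) = lift p @: porbit s k.
Proof.
apply/setP=> y; apply/porbitP/imsetP => [[i ->]|[x /porbitP[i ->] ->]].
  by exists ((s ^+ i)%g k); rewrite ?mem_porbit ?lift_perm_exp.
by exists i; rewrite lift_perm_exp.
Qed.

Lemma porbit_lift_perm_id p s : porbit (lift_perm p p s) p = [set p].
Proof.
apply/setP=> y; rewrite inE; apply/porbitP/eqP => [[i ->]|->]; last first.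
  by exists 0%N; rewrite expg0 perm1.
by elim: i => [|i IH]; rewrite ?expg0 ?perm1 // expgSr permM IH lift_perm_id.
Qed.

Lemma cyc_lift_perm p s : cyc (lift_perm p p s) = (cyc s).+1.
Proof.
pose L (A : {set 'I_n}) := lift p @: A.
have -> : cyc s = #|L @: porbits s|.
  by rewrite card_imset //; apply/imset_inj/lift_inj.
have -> : #|L @: porbits s|.+1
        = #|[set p] |: L @: porbits s|.
  rewrite cardsU1 -[LHS]add1n; suff -> : [set p] \notin L @: porbits s by [].
  apply/negP => /imsetP[].
  move=> A _ /setP/(_ p); rewrite inE eqxx => /esym/imsetP[k _ /eqP].
  by apply/negP; apply: neq_lift.
rewrite /cyc; apply: eq_card => A; rewrite !inE.
apply/imsetP/orP => [[k _ ->]|].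
  case: (unliftP p k) => [j|] ->; last by left; rewrite porbit_lift_perm_id.
  right; rewrite porbit_lift_perm; apply/imsetP; exists (porbit s j) => //.
  exact: imset_f.
case=> [/eqP ->|/imsetP[B /imsetP[j _ ->] ->]].
  by exists p; rewrite ?porbit_lift_perm_id.
by exists (lift p j); rewrite ?porbit_lift_perm.
Qed.

(** When the out-slot p is joined to the in-slot q, the path that starts at q is
appended to the path that ends at p: the start that v sent to p is now sent to
v q. The product with the transposition does this and moves q to p, so that q
and p can be deleted. If v q = p the path becomes a cycle and disappears. *)
Definition reglue p q v : 'S_n := drop_perm q (v * tperm (v q) p)%g.

Lemma lift_reglue p q v : lift_perm q p (reglue p q v) = (v * tperm (v q) p)%g.
Proof.
by rewrite -[RHS](lift_drop_perm q) /reglue permM tpermL.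
Qed.

(** Up to the transposition of v q and p, the product is a permutation for which
p is a fixed point. If v q = p that point is a cycle to be removed; otherwise
the transposition merges it with another cycle. *)
Lemma cyc_contract p q v s :
  cyc (lift_perm p q s * v)%g = (cyc (s * reglue p q v)%g + (v q == p))%N.
Proof.
set r := (s * reglue p q v)%g; set z := v q.
have -> : (lift_perm p q s * v)%g = (lift_perm p p r * tperm z p)%g.
  by rewrite -(lift_permM _ q) lift_reglue -!mulgA tperm2 mulg1.
set w := lift_perm p p r.
have -> : cyc (w * tperm z p)%g = cyc (tperm z p * w^-1)%g.
  by rewrite /cyc -porbitsV invMg tpermV.
have [zp|zp] := eqVneq z p.
  by rewrite zp tperm1 mul1g /cyc porbitsV -/(cyc w) cyc_lift_perm addn1.
have := porbits_mul_tperm w^-1 z p; rewrite /= zp porbitsV -/(cyc w).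
by rewrite porbitV porbit_lift_perm_id inE zp cyc_lift_perm addn1 addn2 addn0
  => -[].
Qed.

(** Vertices above the deleted slots are still paths of length zero, so v keeps
fixing them after relabelling. *)
Lemma reglue_id (h : nat) p q v :
    (p <= h)%N -> (q <= h)%N ->
    (forall k : 'I_n.+1, (h < k)%N -> v k = k) ->
  forall k : 'I_n, (h <= k)%N -> reglue p q v k = k.
Proof.
move=> ph qh vid k hk; apply: (@lift_inj _ p).
have eqk : lift p k = lift q k by apply: val_inj; rewrite /= /bump; lia.
have hlk : (h < lift q k)%N by rewrite /= /bump; lia.
rewrite -(lift_perm_lift q) lift_reglue permM (vid (lift q k)) // eqk tpermD //.
  rewrite -{1}[lift q k]vid // (inj_eq (@perm_inj _ v)); exact: neq_lift.
by rewrite -eqk; apply: neq_lift.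
Qed.

End Contraction.

(** * Local weights *)

Lemma ltn_lift n (p : 'I_n.+1) (i j : 'I_n) : (lift p i < lift p j)%N =
  (i < j)%N.
Proof. by rewrite /= /bump; lia. Qed.

Lemma card_lift n (p : 'I_n.+1) (P : pred 'I_n.+1) :
  #|[set i | P i]| = (P p + #|[set i | P (lift p i)]|)%N.
Proof.
rewrite -!sum1dep_card big_mkcond (bigD1_ord p) //= -big_mkcond /=.
by case: (P p).
Qed.

Lemma card_segment n y x :
  (x <= n)%N -> #|[set i : 'I_n | (y <= i < x)%N]| = (x - y)%N.
Proof.
rewrite -sum1dep_card big_mkcond /=; elim: n x => [|n IH] x xn.
  by rewrite big_ord0; lia.
rewrite big_ord_recr /=; have [xn'|xn'] := leqP x n.
  by rewrite IH // andbF addn0.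
have -> : x = n.+1 by lia.
rewrite andbT (eq_bigr (fun i : 'I_n => if (y <= i < n)%N then 1%N else 0%N)).
  by rewrite IH //; case: leqP; lia.
move=> i _ /=; have lin := ltn_ord i.
by rewrite lin; have -> : (i < n.+1)%N by lia.
Qed.

Lemma card_reparam (aT rT : finType) (F : aT -> rT) (Q : pred rT) :
    injective F -> (forall x, Q x -> exists i, x = F i) ->
  #|[set x | Q x]| = #|[set i | Q (F i)]|.
Proof.
move=> injF QF; rewrite -(card_imset _ injF); apply: eq_card => x.
rewrite inE; apply/idP/imsetP => [q|[i]]; last by rewrite inE => q ->.
by have [i xE] := QF _ q; exists i; rewrite ?inE -?xE.
Qed.

Section LocalStatistics.
Variables (n : nat) (u : 'S_n).
Implicit Types k : 'I_n.

(** The rank of the arc ending at k among the upper arcs open just before k,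
ordered by their starting vertices. *)
Definition upper_rank k : nat :=
  #|[set i : 'I_n | (i < (u^-1)%g k)%N && (k < u i)%N]|.
(** The other lower arcs open at k are split according to the side of u k on
which they end. *)
Definition lower_above k : nat :=
  #|[set l : 'I_n | (k < l)%N && (u k < u l < k)%N]|.
Definition lower_below k : nat :=
  #|[set l : 'I_n | (k < l)%N && (u l < u k)%N]|.

(** Any upper arc above k either crosses or nests the arc leaving k. *)
Lemma ucross_unest k : (k < u k)%N -> (ucross u k + unest u k)%N = lev u k.
Proof.
move=> kuk; rewrite /ucross /unest /lev.
rewrite (card_reparam (F := fun i => (i, u i, u k))); last 2 first.
- by move=> i j [].
- by case=> [[i x] l] /= /and5P[_ _ _ /eqP -> /eqP ->]; exists i.
rewrite (card_reparam (F := fun i => (i, u k, u i))); last 2 first.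
- by move=> i j [].
- by case=> [[i x] l] /= /and5P[_ _ _ /eqP -> /eqP ->]; exists i.
rewrite -[RHS](cardsID [set i | (u i < u k)%N]); congr (_ + _)%N.
  by apply: eq_card => i; rewrite !inE !eqxx !andbT andbA.
apply: eq_card => i; rewrite !inE !eqxx !andbT kuk -leqNgt.
have [->|iNk] := eqVneq i k; first by rewrite !ltnn /= andbF.
have : (u i : nat) != u k by rewrite (inj_eq val_inj) (inj_eq perm_inj).
by case: (i < k)%N; lia.
Qed.

Lemma lcross_lower_above k : (u k < k)%N -> lcross u k = lower_above k.
Proof.
move=> ukk; rewrite /lcross (card_reparam (F := fun l => (u k, u l, l))).
- by apply: eq_card => l; rewrite !inE !eqxx !andbT; case: (k < l)%N;
  rewrite ?andbT ?andbF.
- by move=> i j [].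
- by case=> [[i j] l] /= /and5P[_ _ _ /eqP -> /eqP ->]; exists l.
Qed.

Lemma lnest_lower_below k : (u k < k)%N -> lnest u k = lower_below k.
Proof.
move=> ukk; rewrite /lnest (card_reparam (F := fun l => (u l, u k, l))).
- by apply: eq_card => l; rewrite !inE !eqxx !andbT ukk andbC.
- by move=> i j [].
- by case=> [[i j] l] /= /and5P[_ _ _ /eqP -> /eqP ->]; exists l.
Qed.

Lemma unest_upper_rank k :
  ((u^-1)%g k < k)%N -> unest u ((u^-1)%g k) = upper_rank k.
Proof.
move=> vkk; rewrite /unest (card_reparam (F := fun i => (i, k, u i))).
- by apply: eq_card => i; rewrite !inE permKV !eqxx !andbT vkk.
- by move=> i j [].
- by case=> [[i x] l] /=; rewrite permKV => /and5P[_ _ _ /eqP -> /eqP ->];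
  exists i.
Qed.

End LocalStatistics.

Section Weights.
Variables (R : comNzRingType) (a : nat -> R) (b c d : nat -> nat -> R)
          (e : nat -> R) (lam : R).

Definition vertex_weight n (u : 'S_n) (k : 'I_n) : R :=
  if u k == k then e (lev u k)
  else if (k < (u^-1)%g k)%N then
    if (k < u k)%N then a (lev u k) else c (lower_above u k) (lower_below u k)
  else
    if (k < u k)%N then d (lev u k) (upper_rank u k)
    else b (lower_above u k) (lower_below u k).

Lemma perm_fixV n (u : 'S_n) (k : 'I_n) : ((u^-1)%g k == k) = (u k == k).
Proof. by apply/eqP/eqP => {1}<-; rewrite ?permK ?permKV. Qed.

Lemma Qhat_weight n :
  Qhat a b c d e lam n =
  \sum_(u : 'S_n) lam ^+ cyc u * \prod_k vertex_weight u k.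
Proof.
apply: eq_bigr => u _; rewrite -!mulrA; congr (_ * _).
rewrite big_mkcond [X in _ * (X * _)]big_mkcond.
rewrite [X in _ * (_ * (X * _))]big_mkcond.
rewrite [X in _ * (_ * (_ * (X * _)))]big_mkcond.
rewrite [X in _ * (_ * (_ * (_ * X)))]big_mkcond -!big_split /=.
apply: eq_bigr => k _; rewrite /vertex_weight /cval /cpeak /cdfall /cdrise
  /cfix.
have := perm_fixV u k; have [ukk|ukk vkk] := eqVneq (u k) k.
  by move=> /eqP vkk; rewrite ukk vkk !ltnn !mul1r.
have nat_neq (x : 'I_n) : (x == k) = false -> (x : nat) != k.
  by move=> xk; rewrite (inj_eq val_inj) xk.
case: ltngtP (nat_neq _ vkk) => // lv _;
  case: ltngtP (nat_neq _ (negPf ukk)) => // lu _; rewrite ?(mul1r, mulr1) //.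
all: by rewrite ?lcross_lower_above ?lnest_lower_below ?ucross_unest
  ?unest_upper_rank.
Qed.

Section Removal.
Variables (n h : nat) (p q : 'I_n.+1).
Hypotheses (ph : (p <= h)%N) (qh : (q <= h)%N).

(** The deleted arc joins two slots to the left of the vertex, so it belongs to
none of the configurations counted there. *)
Lemma vertex_weight_lift (s : 'S_n) (k : 'I_n) :
  (h <= k)%N -> vertex_weight (lift_perm p q s) (lift p k) = vertex_weight s k.
Proof.
move=> hk; have eqk : lift p k = lift q k by apply: val_inj; rewrite /= /bump;
  lia.
have pk : (p < lift p k)%N by rewrite /= /bump; lia.
have qk : (q < lift q k)%N by rewrite /= /bump; lia.
have uE i : lift_perm p q s (lift p i) = lift q (s i) by rewrite lift_perm_lift.
have vk : ((lift_perm p q s)^-1)%g (lift p k) = lift p ((s^-1)%g k).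
  by rewrite lift_permV eqk lift_perm_lift.
have lt_in i : (lift q i < lift p k)%N = (i < k)%N by rewrite eqk ltn_lift.
have lt_in' i : (lift p k < lift q i)%N = (k < i)%N by rewrite eqk ltn_lift.
have levE : lev (lift_perm p q s) (lift p k) = lev s k.
  rewrite /lev (card_lift p) lift_perm_id eqk (ltnNge _ q) (ltnW qk) andbF
    add0n -eqk.
  by apply: eq_card => i; rewrite !inE uE ltn_lift lt_in'.
have upE : upper_rank (lift_perm p q s) (lift p k) = upper_rank s k.
  rewrite /upper_rank (card_lift p) lift_perm_id eqk (ltnNge _ q) (ltnW qk)
    andbF add0n.
  by rewrite -eqk vk; apply: eq_card => i; rewrite !inE uE ltn_lift lt_in'.
have aboveE : lower_above (lift_perm p q s) (lift p k) = lower_above s k.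
  rewrite /lower_above (card_lift p) (ltnNge _ p) (ltnW pk) add0n.
  by apply: eq_card => i; rewrite !inE !uE !ltn_lift lt_in.
have belowE : lower_below (lift_perm p q s) (lift p k) = lower_below s k.
  rewrite /lower_below (card_lift p) (ltnNge _ p) (ltnW pk) add0n.
  by apply: eq_card => i; rewrite !inE !uE !ltn_lift.
rewrite /vertex_weight levE upE aboveE belowE vk uE !ltn_lift lt_in'.
by rewrite eqk (inj_eq (@lift_inj _ q)).
Qed.

(** What the vertices from t on contribute to the sum, when the first t letters
stand for open paths that v closes up. *)
Definition tail_weight m t (u v : 'S_m) : R :=
  lam ^+ cyc (u * v)%g * \prod_(k : 'I_m | (t <= k)%N) vertex_weight u k.

Lemma tail_weight_lift (s : 'S_n) v :
  tail_weight h.+1 (lift_perm p q s) v =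
    lam ^+ (v q == p) * tail_weight h s (reglue p q v).
Proof.
rewrite /tail_weight cyc_contract addnC exprD -!mulrA; congr (_ * (_ * _)).
rewrite big_mkcond (bigD1_ord p) //= ltnNge ph /= mul1r [RHS]big_mkcond /=.
apply: eq_bigr => k _.
have -> : (h < bump p k)%N = (h <= k)%N by rewrite /bump; lia.
by case: ifP => // hk; rewrite vertex_weight_lift.
Qed.

(** The first t out-slots and in-slots are the ends of the paths open just
before vertex t, so an arc between two of them would have been closed earlier.
*)
Definition keeps_open m t (u : 'S_m) : bool :=
  [forall j : 'I_m, (j < t)%N ==> (t <= u j)%N].

Lemma keeps_open_lift (s : 'S_n) :
  keeps_open h s =
  [forall j : 'I_n.+1, (j <= h)%N && (j != p) ==> (h < lift_perm p q s j)%N].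
Proof.
apply/forallP/forallP => [iso j|iso j].
  apply/implyP => /andP[jh]; case: (unliftP p j) jh => [i|] ->;
    last by rewrite eqxx.
  move=> /= lih _; rewrite lift_perm_lift /=; have := implyP (iso i).
  by move: lih; rewrite /bump; lia.
apply/implyP => jh; have := implyP (iso (lift p j)).
rewrite lift_perm_lift [_ == p]eq_sym neq_lift andbT /= /bump; lia.
Qed.

End Removal.

Section Vertex.
Variables (n : nat) (u : 'S_n) (o : 'I_n).
Hypothesis iso : keeps_open o u.
Implicit Types i j l : 'I_n.

Lemma keeps_openP j : (j < o)%N -> (o <= u j)%N.
Proof. exact/implyP/(forallP iso). Qed.

Lemma lev_opened : (o <= (u^-1)%g o)%N -> lev u o = o.
Proof.
move=> ov; rewrite -[RHS]subn0 -(card_segment 0 (ltnW (ltn_ord o))).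
apply: eq_card => i; rewrite !inE /=; case: ltnP => //= io.
rewrite ltn_neqAle keeps_openP // andbT; apply/negP => /eqP oE.
by move: ov io; rewrite (val_inj oE : o = u i) permK; lia.
Qed.

Lemma lev_closed : ((u^-1)%g o < o)%N -> lev u o = (o - 1)%N.
Proof.
move=> vo; have := card_segment 0 (ltnW (ltn_ord o)); rewrite subn0 => <-.
rewrite [in RHS](cardsD1 ((u^-1)%g o)) inE /= vo addKn.
apply: eq_card => i; rewrite !inE /=; case: ltnP => io; rewrite ?andbF // andbT.
by rewrite ltn_neqAle keeps_openP //
  andbT -(can2_eq (permK u) (permKV u)) eq_sym (inj_eq val_inj).
Qed.

Lemma upper_rank_closed : ((u^-1)%g o < o)%N -> upper_rank u o = (u^-1)%g o.
Proof.
move=> vo; rewrite -[RHS]subn0 -(card_segment 0 (ltnW (ltn_ord _))).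
apply: eq_card => i; rewrite !inE /=; case: ltnP => //= io.
have oi : (o <= u i)%N by apply: keeps_openP; lia.
rewrite ltn_neqAle oi andbT; apply/negP => /eqP oE.
by move: io; rewrite (val_inj oE : o = u i) permK ltnn.
Qed.

Lemma lower_arc l : (u l < o)%N -> (u l : nat) != u o -> (o < l)%N.
Proof.
move=> lo lu; rewrite ltn_neqAle; apply/andP; split.
  by apply: contraNneq lu => /val_inj ->.
by rewrite leqNgt; apply/negP => /keeps_openP; rewrite leqNgt lo.
Qed.

Lemma lower_below_closed : (u o < o)%N -> lower_below u o = u o.
Proof.
move=> uo; rewrite -[RHS]subn0 -(card_segment 0 (ltnW (ltn_ord _))).
rewrite -(card_preimset _ (@perm_inj _ u)); apply: eq_card => l;
  rewrite !inE /=.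
case: (ltnP (u l)) => lu; rewrite ?andbF // andbT; apply: lower_arc; lia.
Qed.

Lemma lower_above_closed : (u o < o)%N -> lower_above u o = (o - 1 - u o)%N.
Proof.
move=> uo; have := card_segment (u o).+1 (ltnW (ltn_ord o)).
have -> : (o - (u o).+1 = o - 1 - u o)%N by lia.
move=> <-; rewrite -(card_preimset _ (@perm_inj _ u)); apply: eq_card => l.
rewrite !inE; apply: andb_idl => /andP[lu lo].
by apply: lower_arc => //; rewrite neq_ltn lu orbT.
Qed.

End Vertex.

(** The deleted arc uses at least one of the two slots of o. If the other one is
not deleted too, it takes the place of an old slot among the open ones, so it
must be joined to the right of o. *)
Lemma keeps_open_remove n (o p q : 'I_n) (u : 'S_n) :
    u p = q -> (p <= o)%N -> (q <= o)%N -> (p == o) || (q == o) ->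
  [forall j : 'I_n, (j <= o)%N && (j != p) ==> (o < u j)%N]
  = [&& keeps_open o u, (p == o) || (o < u o)%N
      & (q == o) || (o < (u^-1)%g o)%N].
Proof.
move=> upq po qo pqo.
have neqo (i : 'I_n) : i != o -> (i : nat) != o by rewrite (inj_eq val_inj).
apply/forallP/and3P => [Hj | [iso Hp Hq] j].
  have {}Hj (j : 'I_n) : (j <= o)%N -> j != p -> (o < u j)%N.
    by move=> jo jp; apply: (implyP (Hj j)); rewrite jo jp.
  split.
  - apply/forallP => j; apply/implyP => jo.
    have [jp|/Hj] := eqVneq j p; last by move=> /(_ (ltnW jo)); apply: ltnW.
    move: pqo; rewrite jp upq => /orP[/eqP po'|/eqP -> //].
    by move: jo; rewrite jp po' ltnn.
  - by have [//|op] := eqVneq p o; rewrite Hj // eq_sym.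
  - have [//|oq] := eqVneq q o; rewrite ltnNge; apply/negP => vo.
    have /(Hj _ vo) : (u^-1)%g o != p.
      by apply: contraNneq oq => vp; rewrite -upq -vp permKV.
    by rewrite permKV ltnn.
apply/implyP => /andP[jo jp].
have [jo'|/neqo jNo] := eqVneq j o.
  by move: Hp; rewrite jo' eq_sym -jo' (negPf jp).
have ltjo : (j < o)%N by rewrite ltn_neqAle jNo.
rewrite ltn_neqAle (keeps_openP iso) // andbT; apply/negP => /eqP/val_inj ouj.
case/orP: Hq => [/eqP oq|].
  by case/eqP: jp; apply: (@perm_inj _ u); rewrite upq oq.
by move: ltjo; rewrite ouj permK; lia.
Qed.

(** Summing over u is summing over all completions of a partial permutation
whose h open paths are described by v. *)
Definition open_sum n h (v : 'S_n) : R :=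
  \sum_(u : 'S_n | keeps_open h u) tail_weight h u v.

(** * The transfer recursion *)

Section Step.
Variables (n : nat) (o : 'I_n.+1) (v : 'S_n.+1).
Hypothesis vid : forall k : 'I_n.+1, (o <= k)%N -> v k = k.
Implicit Types u : 'S_n.+1.

Lemma tail_weight_vertex u :
  tail_weight o u v = vertex_weight u o * tail_weight o.+1 u v.
Proof.
rewrite /tail_weight (bigD1 o) //= mulrCA; congr (_ * (_ * _));
  apply: eq_bigl => k.
by rewrite ltn_neqAle eq_sym (inj_eq val_inj) andbC eq_sym.
Qed.

Lemma vertex_weight_fix u :
  keeps_open o u -> u o = o -> vertex_weight u o = e o.
Proof.
move=> iso uo; rewrite /vertex_weight uo eqxx lev_opened //.
by move/eqP: uo; rewrite -perm_fixV => /eqP ->.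
Qed.

Lemma vertex_weight_cval u :
    keeps_open o u -> (o < (u^-1)%g o)%N -> (o < u o)%N ->
  vertex_weight u o = a o.
Proof.
move=> iso ov ou; rewrite /vertex_weight ov ou lev_opened 1?ltnW //.
by rewrite -(inj_eq val_inj) gtn_eqF.
Qed.

Lemma vertex_weight_cdrise u :
    keeps_open o u -> ((u^-1)%g o < o)%N -> (o < u o)%N ->
  vertex_weight u o = d (o - 1)%N ((u^-1)%g o).
Proof.
move=> iso vo ou; rewrite /vertex_weight ltnNge (ltnW vo) ou lev_closed //=.
by rewrite upper_rank_closed // -(inj_eq val_inj) gtn_eqF.
Qed.

Lemma vertex_weight_cdfall u :
    keeps_open o u -> (o < (u^-1)%g o)%N -> (u o < o)%N ->
  vertex_weight u o = c (o - 1 - u o)%N (u o).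
Proof.
move=> iso ov uo; rewrite /vertex_weight ov (ltnNge _ (u o)) (ltnW uo) /=.
by rewrite lower_above_closed // lower_below_closed //
  -(inj_eq val_inj) ltn_eqF.
Qed.

Lemma vertex_weight_cpeak u :
    keeps_open o u -> ((u^-1)%g o < o)%N -> (u o < o)%N ->
  vertex_weight u o = b (o - 1 - u o)%N (u o).
Proof.
move=> iso vo uo; rewrite /vertex_weight !(ltnNge o) (ltnW uo) (ltnW vo) /=.
by rewrite lower_above_closed // lower_below_closed //
  -(inj_eq val_inj) ltn_eqF.
Qed.

Lemma sum_fix :
  \sum_(u | keeps_open o u && (u o == o)) tail_weight o u v
  = lam * e o * open_sum o (reglue o o v).
Proof.
rewrite sum_lift_perm /open_sum big_distrr /=; apply: eq_big => [s|s iso].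
  by rewrite (keeps_open_lift (leqnn o) (leqnn o)) (keeps_open_remove
    (lift_perm_id o o s)) ?lift_perm_id ?eqxx ?andbT.
rewrite tail_weight_vertex vertex_weight_fix ?lift_perm_id //
  tail_weight_lift // vid // eqxx expr1.
by rewrite mulrA (mulrC lam).
Qed.

Lemma sum_cval :
  \sum_(u | [&& keeps_open o u, (o < (u^-1)%g o)%N & (o < u o)%N])
    tail_weight o u v
  = a o * open_sum o.+1 v.
Proof.
rewrite /open_sum big_distrr /=; apply: eq_big => [u|u /and3P[iso ov ou]].
  apply/and3P/forallP => [[iso ov ou] j|iso].
    apply/implyP; rewrite ltnS leq_eqVlt => /orP[/eqP/val_inj -> //|jo].
    rewrite ltn_neqAle (keeps_openP iso) // andbT; apply/negP =>
      /eqP/val_inj ouj.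
    by move: ov jo; rewrite ouj permK; lia.
  have {}iso (j : 'I_n.+1) := implyP (iso j).
  split; last exact: iso.
    by apply/forallP => j; apply/implyP => jo; apply/ltnW/iso/ltnW.
  by rewrite ltnNge; apply/negP => /iso; rewrite permKV ltnn.
by rewrite tail_weight_vertex vertex_weight_cval.
Qed.

Lemma sum_cdrise :
  \sum_(u | [&& keeps_open o u, ((u^-1)%g o < o)%N & (o < u o)%N])
    tail_weight o u v
  = \sum_(x < n.+1 | (x < o)%N) d (o - 1)%N x * open_sum o (reglue x o v).
Proof.
rewrite (partition_big (fun u => (u^-1)%g o) (fun x => x < o)%N) /=; last first.
  by move=> u /and3P[].
apply: eq_bigr => x xo.
transitivity (\sum_(u | (keeps_open o u && (o < u o)%N) && (u x == o))
                tail_weight o u v).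
  apply: eq_bigl => u; rewrite (can2_eq (permK u) (permKV u)) eq_sym.
  by have [<-|] := eqVneq; rewrite ?andbF // xo !andbT.
rewrite sum_lift_perm /open_sum big_distrr /=;
  apply: eq_big => [s|s /andP[iso ou]].
  rewrite (keeps_open_lift (ltnW xo) (leqnn o)) (keeps_open_remove
    (lift_perm_id x o s)) //.
  - by rewrite eqxx andbT -(inj_eq val_inj) ltn_eqF.
  - exact: ltnW.
  - by rewrite eqxx orbT.
have vo : ((lift_perm x o s)^-1)%g o = x by rewrite lift_permV lift_perm_id.
rewrite tail_weight_vertex vertex_weight_cdrise ?vo //
  tail_weight_lift ?(ltnW xo) // vid //.
by rewrite -(inj_eq val_inj) gtn_eqF // expr0 mul1r.
Qed.

Lemma sum_cdfall :
  \sum_(u | [&& keeps_open o u, (o < (u^-1)%g o)%N & (u o < o)%N])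
    tail_weight o u v
  = \sum_(y < n.+1 | (y < o)%N) c (o - 1 - y)%N y * open_sum o (reglue o y v).
Proof.
rewrite (partition_big (fun u => u o) (fun y => y < o)%N) /=; last first.
  by move=> u /and3P[].
apply: eq_bigr => y yo.
transitivity (\sum_(u | (keeps_open o u && (o < (u^-1)%g o)%N) && (u o == y))
                tail_weight o u v).
  apply: eq_bigl => u; have [->|] := eqVneq; last by rewrite !andbF.
  by rewrite yo !andbT.
rewrite sum_lift_perm /open_sum big_distrr /=;
  apply: eq_big => [s|s /andP[iso ov]].
  rewrite (keeps_open_lift (leqnn o) (ltnW yo)) (keeps_open_remove
    (lift_perm_id o y s)) //.
  - by rewrite eqxx /= -(inj_eq val_inj) ltn_eqF.
  - exact: ltnW.
  - by rewrite eqxx.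
rewrite tail_weight_vertex vertex_weight_cdfall ?lift_perm_id //
  tail_weight_lift ?(ltnW yo) //.
suff -> : (v y == o) = false by rewrite expr0 mul1r.
by rewrite -[in LHS](vid (leqnn o)) (inj_eq (@perm_inj _ v)) -(inj_eq val_inj)
  ltn_eqF.
Qed.

(** The only x that closes a cycle is the end of the path that starts at y.
Since v permutes the letters below o, it does lie below o. *)
Lemma sum_closing (y : 'I_n) : (y < o)%N ->
  \sum_(x < n.+1 | (x < o)%N) lam ^+ (v (lift o y) == x) = lam + o%:R - 1.
Proof.
move=> yo; set z := v (lift o y).
have zo : (z < o)%N.
  rewrite ltnNge; apply/negP => /[dup] oz /vid /perm_inj zE.
  by move: oz; rewrite zE /= /bump; lia.
have sum1 : o%:R = \sum_(x < n.+1 | (x < o)%N) 1 :> R.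
  by rewrite -[in LHS](subn0 o) -(card_segment 0 (ltnW (ltn_ord o)))
    -sum1dep_card natr_sum.
rewrite sum1 (bigD1 z) // [in RHS](bigD1 z) //= eqxx expr1.
rewrite (eq_bigr (fun=> 1)) => [|x /andP[_]]; first by ring.
by rewrite eq_sym => /negPf ->; rewrite expr0.
Qed.

End Step.

Section Peak.
Variables (n : nat) (o : 'I_n.+2) (v : 'S_n.+2) (o' : 'I_n.+1).
Hypothesis vid : forall k : 'I_n.+2, (o <= k)%N -> v k = k.
Hypothesis oS : o = o'.+1 :> nat.
Implicit Types u : 'S_n.+2.

(** The arc from x to o is deleted first. The out-slot of o then has position o'
and is joined to the in-slot y, still in position y because y < o. *)
Lemma keeps_open_cpeak (x : 'I_n.+2) (y : 'I_n.+1) (s : 'S_n) :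
  (x < o)%N -> (y < o)%N ->
  keeps_open o (lift_perm x o (lift_perm o' y s)) = keeps_open o' s.
Proof.
move=> xo yo; rewrite (keeps_open_lift (leqnn o') (_ : y <= o')%N); last by lia.
set s' := lift_perm o' y s.
apply/forallP/forallP => [iso i|iso j].
  apply/implyP => /andP[io]; rewrite -(inj_eq val_inj) /= => iNo.
  have /= := implyP (iso (lift x i)).
  by rewrite lift_perm_lift /= /bump;
    move: (nat_of_ord (s' i)) (nat_of_ord i) io iNo => t k; lia.
apply/implyP => jo; case: (unliftP x j) jo => [i|] ->;
  last by rewrite lift_perm_id.
have := implyP (iso i); rewrite lift_perm_lift -(inj_eq val_inj) /= /bump.
move: (nat_of_ord (s' i)) (nat_of_ord i) => t k; lia.
Qed.

(** Once x has been joined to o, the path ending at o is the one that used to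
end at x. *)
Lemma reglue_eq (x : 'I_n.+2) (y : 'I_n.+1) :
  (x < o)%N -> (y < o)%N -> (reglue x o v y == o') = (v (lift o y) == x).
Proof.
move=> xo yo; rewrite -(inj_eq (@lift_inj _ x)) -(lift_perm_lift o) lift_reglue
  permM.
have -> : lift x o' = o by apply: val_inj; rewrite /= /bump; lia.
by rewrite (vid (leqnn o)) (can2_eq (tpermK _ _) (tpermK _ _)) tpermL.
Qed.

Lemma sum_cpeak :
  \sum_(u | [&& keeps_open o u, ((u^-1)%g o < o)%N & (u o < o)%N])
    tail_weight o u v
  = \sum_(x < n.+2 | (x < o)%N) \sum_(y < n.+1 | (y < o)%N)
      b (o - 1 - y)%N y * lam ^+ (v (lift o y) == x)
      * open_sum o' (reglue o' y (reglue x o v)).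
Proof.
rewrite (partition_big (fun u => (u^-1)%g o) (fun x => x < o)%N) /=; last first.
  by move=> u /and3P[].
apply: eq_bigr => x xo.
transitivity (\sum_(u | (keeps_open o u && (u o < o)%N) && (u x == o))
                tail_weight o u v).
  apply: eq_bigl => u; rewrite (can2_eq (permK u) (permKV u)) eq_sym.
  by have [<-|] := eqVneq; rewrite ?andbF // xo !andbT.
have oE : lift x o' = o by apply: val_inj; rewrite /= /bump; lia.
have uo (s : 'S_n.+1) : lift_perm x o s o =
  lift o (s o') by rewrite -{2}oE lift_perm_lift.
rewrite sum_lift_perm (partition_big (fun s : 'S_n.+1 => s o') (fun y =>
  y < o)%N) /=; last first.
  by move=> s /andP[_]; rewrite uo /= /bump; lia.
apply: eq_bigr => y yo; rewrite sum_lift_perm /open_sum big_distrr /=.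
have valy : lift o y = y :> nat by rewrite /= /bump; lia.
apply: eq_big => [s|s /andP[iso ltuo]].
  by rewrite keeps_open_cpeak // uo lift_perm_id valy yo andbT.
have vo : ((lift_perm x o (lift_perm o' y s))^-1)%g o =
  x by rewrite lift_permV lift_perm_id.
rewrite tail_weight_vertex vertex_weight_cpeak ?vo //
  uo lift_perm_id valy -mulrA; congr (_ * _).
rewrite tail_weight_lift ?(ltnW xo) // vid // -(inj_eq val_inj) gtn_eqF //
  expr0 mul1r.
by rewrite [in LHS]oS tail_weight_lift ?reglue_eq //; lia.
Qed.

End Peak.

Let gam h : R := pred_star c h + pred_natural d h + lam * e h.
Let down h : R := (lam + h%:R - 1) * pred_star b h.
Local Notation motzkin := (motzkin gam a down).

Lemma sum_ord_lt n h (F : nat -> R) :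
  (h <= n)%N -> \sum_(x < n | (x < h)%N) F x = \sum_(x < h) F x.
Proof. by move=> hn; rewrite [RHS](big_ord_widen n). Qed.

(** The first index of f is the number of arcs above rank y, hence the reversal
of the order of summation. *)
Lemma sum_pred_star n h (f : nat -> nat -> R) : (h <= n)%N ->
  \sum_(y < n | (y < h)%N) f (h - 1 - y)%N y = pred_star f h.
Proof.
move=> hn; rewrite (sum_ord_lt (fun y => f (h - 1 - y)%N y)) //.
rewrite (reindex_inj rev_ord_inj) /=; apply: eq_bigr => y _.
by congr f; have := ltn_ord y; lia.
Qed.

Lemma sum_pred_natural n h (f : nat -> nat -> R) : (h <= n)%N ->
  \sum_(x < n | (x < h)%N) f (h - 1)%N x = pred_natural f h.
Proof. by move=> hn; rewrite (sum_ord_lt (f (h - 1)%N)). Qed.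

(** The completions are classified by the type of vertex h. Apart from a cycle
peak, where the two arcs at h are deleted one after the other, each type leads
to a state with one vertex less to read, and to a v that enters only through
the induction hypothesis, which forgets it. *)
Lemma open_sum_motzkin n h m (v : 'S_n) :
    n = (h + m)%N -> (forall k : 'I_n, (h <= k)%N -> v k = k) ->
  open_sum h v = motzkin m h.
Proof.
elim: m h n v => [|m IH] h n v.
  rewrite addn0 => nE _; subst n; rewrite /open_sum /tail_weight.
  case: h v => [|h] v /=.
    rewrite (big_pred1 1%g) => [|u]; last first.
      have -> : u = 1%g by apply/permP => -[].
      by rewrite /= eqxx; apply/forallP => -[].
    rewrite big_ord0 mulr1; have -> // : cyc (1 * v)%g = 0%N.
    by apply/eqP; rewrite -leqn0 (leq_trans (leq_imset_card _ _)) ?card_ord.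
  (* With no vertex left to read, an open path cannot be continued. *)
  by rewrite big1 // => u /forallP/(_ ord0) /=; rewrite leqNgt ltn_ord.
rewrite addnS => nE; subst n => vid.
have ho : (h < (h + m).+1)%N by rewrite ltnS leq_addr.
pose o : 'I_(h + m).+1 := Ordinal ho.
have vido (k : 'I_(h + m).+1) : (o <= k)%N -> v k = k by apply: vid.
have IHreg (p q : 'I_(h + m).+1) :
    (p <= o)%N -> (q <= o)%N -> open_sum h (reglue p q v) = motzkin m h.
  move=> po qo; apply: IH => // k hk; apply: (reglue_id po qo) => // j hj.
  by apply: vid; apply: ltnW.
have hn := ltnW ho.
rewrite /open_sum (bigID (fun u : 'S_(h + m).+1 => u o == o)) /=.
rewrite (sum_fix vido) IHreg //.
rewrite (bigID (fun u : 'S_(h + m).+1 => (o < (u^-1)%g o)%N)) /=.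
rewrite (bigID (fun u : 'S_(h + m).+1 => (o < u o)%N)) /=.
rewrite [X in _ + (_ + X)](bigID (fun u : 'S_(h + m).+1 => (o < u o)%N)) /=.
have neq_o (u : 'S_(h + m).+1) : (u o == o) = ((u o : nat) == h) by [].
have neq_vo (u : 'S_(h + m).+1) : (u o == o) = (((u^-1)%g o : nat) == h).
  by rewrite -perm_fixV.
have -> : \sum_(u | keeps_open o u && (u o != o) && (o < (u^-1)%g o)%N
                 && (o < u o)%N) tail_weight h u v
    = a h * motzkin m h.+1.
  rewrite -(IH h.+1 _ v) //; last by move=> k /ltnW/vid.
  apply: etrans (sum_cval o v); apply: eq_bigl => u; rewrite neq_o /=.
  by case: (keeps_open _ _) => //=; lia.
have -> : \sum_(u | keeps_open o u && (u o != o) && (o < (u^-1)%g o)%N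
                 && ~~ (o < u o)%N) tail_weight h u v
    = pred_star c h * motzkin m h.
  rewrite -(sum_pred_star c hn) big_distrl /=.
  under [RHS]eq_bigr => y yo do rewrite -(IHreg o y (leqnn o) (ltnW yo)).
  apply: etrans (sum_cdfall vido); apply: eq_bigl => u; rewrite neq_o /=.
  by case: (keeps_open _ _) => //=; lia.
have -> : \sum_(u | keeps_open o u && (u o != o) && ~~ (o < (u^-1)%g o)%N
                 && (o < u o)%N) tail_weight h u v
    = pred_natural d h * motzkin m h.
  rewrite -(sum_pred_natural d hn) big_distrl /=.
  under [RHS]eq_bigr => x xo do rewrite -(IHreg x o (ltnW xo) (leqnn o)).
  apply: etrans (sum_cdrise vido); apply: eq_bigl => u; rewrite neq_vo /=.
  by case: (keeps_open _ _) => //=; lia.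
have -> : \sum_(u | keeps_open o u && (u o != o) && ~~ (o < (u^-1)%g o)%N
                 && ~~ (o < u o)%N) tail_weight h u v
    = (if h is h'.+1 then down h * motzkin m h' else 0).
  case: h => [|h] in IH v vid ho o vido hn IHreg neq_o neq_vo *.
    rewrite big_pred0 => [|u]; first by [].
    by rewrite neq_vo /= lt0n negbK; case: eqP; rewrite ?andbF.
  have ho' : (h < (h + m).+1)%N by rewrite ltnS leq_addr.
  pose o' : 'I_(h + m).+1 := Ordinal ho'.
  transitivity (\sum_(y < (h + m).+1 | (y < o)%N) b (o - 1 - y)%N y *
      ((\sum_(x < (h + m).+2 | (x < o)%N) lam ^+ (v (lift o y) == x))
       * motzkin m h)).
    under [RHS]eq_bigr => y yo do rewrite big_distrl big_distrr /=.
    rewrite [RHS]exchange_big /=.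
    transitivity (\sum_(u | [&& keeps_open o u, ((u^-1)%g o < o)%N
                               & (u o < o)%N]) tail_weight o u v).
      apply: eq_bigl => u; rewrite neq_o /=; have := neq_vo u; rewrite neq_o.
      by case: (keeps_open _ _) => //=; lia.
    rewrite (sum_cpeak (o' := o')) //; apply: eq_bigr => x xo;
      apply: eq_bigr => y yo.
    rewrite mulrA; congr (_ * _); apply: IH => // k hk.
    apply: (@reglue_id _ h) => // j hj; apply: (@reglue_id _ h.+1) => //.
      exact: ltnW.
    by move=> i hi; apply: vid; apply: ltnW.
  under eq_bigr => y yo do rewrite (sum_closing vido) //.
  rewrite -big_distrl /= sum_pred_star // /down; ring.
set peaks := (if h is h'.+1 then _ else _).
have -> : motzkin m.+1 h =
  gam h * motzkin m h + a h * motzkin m h.+1 + peaks by [].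
move: peaks => peaks; rewrite [gam h]/gam; ring.
Qed.

(** Before any vertex is read there is no path: the permutation v is trivial. *)
Lemma open_sum0 n : open_sum 0 (1 : 'S_n) = Qhat a b c d e lam n.
Proof.
rewrite Qhat_weight; apply: eq_big => [u|u _]; first by apply/forallP.
by rewrite /tail_weight mulg1.
Qed.

End Weights.

Theorem theorem2p14 (R : comNzRingType) (a : nat -> R)
    (b c d : nat -> nat -> R) (e : nat -> R) (lam : R) :
  is_Jfraction (Qhat a b c d e lam)
    (fun n => pred_star c n + pred_natural d n + lam * e n)
    (fun n => (lam + n%:R - 1) * a (n - 1)%N * pred_star b n).
Proof.
apply: (motzkin_Jfraction (up := a)
          (down := fun h => (lam + h%:R - 1) * pred_star b h)) => [h|n].
  by rewrite subn1 /= mulrA [a h * _]mulrC.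
by rewrite -(@open_sum_motzkin _ a b c d e lam n 0 n 1%g) ?open_sum0 // => k _;
  rewrite perm1.
Qed.
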